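(* Let $K_n$ be the complete graph with $n$ vertices. For every integer $h$ with $1\le h\le n-1$, the number of paths with length $h$ in $K_n$ is $$P_h(K_n)=\frac12\prod_{i=0}^{h}(n-i).$$ Consequently the path sequence of $K_n$ is $$P(K_n)=\Big(n,\ \frac{n(n-1)}{2},\ \frac{n(n-1)(n-2)}{2},\ \ldots,\ \frac12\prod_{i=0}^{h}(n-i),\ \ldots,\ \frac12\prod_{i=0}^{n-1}(n-i)\Big),$$ that is, $P_0(K_n)=n$, the entry of index $h$ is $\frac12\prod_{i=0}^{h}(n-i)$ for $1\le h\le n-1$, and the last index is $n-1$.
   Context: Graphs are finite and simple. A path of length $h$ in $G$ is a subgraph that is a path with $h$ edges ($h+1$ distinct vertices); paths are undirected, so a vertex sequence and its reversal are the same path, and paths of length $0$ are single vertices. $P_h(G)$ is the number of paths of length $h$ in $G$. The path sequence of $G$ is $P(G)=(P_0(G),P_1(G),\ldots,P_\rho(G))$, where $\rho=\rho(G)$ is the length of a longest path in $G$. *)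

(* Defs.v *)
From mathcomp Require Import all_boot.
Set Implicit Arguments.
Unset Strict Implicit.
Unset Printing Implicit Defensive.

Record sgraph := SGraph {
  vertex :> finType;
  adj : rel vertex;
  adj_sym : symmetric adj;
  adj_irr : irreflexive adj }.

Definition edges (G : sgraph) : {set {set G}} :=
  [set [set x; y] | x in G, y in G & adj x y].

(* A graph whose vertices lie in T is given by its vertex set and its edge
   set, an edge being the unordered pair of its ends; a subgraph of G is such
   a pair. *)
Definition set_graph (T : finType) : Type := ({set T} * {set {set T}})%type.

Definition is_subgraph (G : sgraph) (H : set_graph G) : bool :=
  (H.2 \subset edges G) && [forall e in H.2, e \subset H.1].

(* The vertices of the path are t_0, ..., t_h, its edges are the h pairs
   {t_i, t_(i+1)}; here [lift ord0 i] is the index i + 1.  A vertex sequence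
   and its reversal yield the same graph. *)
Definition is_path_graph (T : finType) (h : nat) (H : set_graph T) : bool :=
  [exists t : h.+1.-tuple T,
     [&& uniq t,
         H.1 == [set x in t]
       & H.2 == [set [set tnth t (widen_ord (leqnSn h) i);
                          tnth t (lift ord0 i)] | i : 'I_h]]].

Definition paths (G : sgraph) (h : nat) : {set {set G} * {set {set G}}} :=
  [set H | is_subgraph H && is_path_graph h H].

Definition num_paths (G : sgraph) (h : nat) : nat := #|paths G h|.

(* Bounding h by the number of vertices loses no path: see
   [num_paths_gt0_lt] and [longestP].  The value is 0 if G has no vertex. *)
Definition longest (G : sgraph) : nat :=
  \max_(h < #|G| | 0 < num_paths G h) h.

Definition path_sequence (G : sgraph) : seq nat :=
  mkseq (num_paths G) (longest G).+1.

Lemma num_paths_gt0_lt (G : sgraph) h : 0 < num_paths G h -> h < #|G|.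
Proof.
case/card_gt0P=> H; rewrite inE => /andP[_ /existsP[t /and3P[Ut _ _]]].
by rewrite -(size_tuple t) -(card_uniqP Ut) max_card.
Qed.

Lemma num_paths0_gt0 (G : sgraph) : 0 < #|G| -> 0 < num_paths G 0.
Proof.
case/card_gt0P=> x _; apply/card_gt0P; exists ([set x], set0).
rewrite inE /is_subgraph sub0set /=; apply/andP; split.
  by apply/forall_inP=> e; rewrite inE.
apply/existsP; exists [tuple x]; rewrite /=; apply/andP; split.
  by apply/eqP/setP=> y; rewrite !inE.
by apply/eqP/setP=> y; rewrite inE; apply/esym/imsetP; case=> [[]].
Qed.

Lemma longestP (G : sgraph) : 0 < #|G| ->
  0 < num_paths G (longest G) /\
  forall h, 0 < num_paths G h -> h <= longest G.
Proof.
move=> G0; split; last first.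
  move=> h Ph; have hG := num_paths_gt0_lt Ph.
  exact: (@leq_bigmax_cond _ (fun h : 'I_#|G| => 0 < num_paths G h)
                           (fun h => h : nat) (Ordinal hG) Ph).
have P0 : 0 < #|[pred h : 'I_#|G| | 0 < num_paths G h]|.
  by apply/card_gt0P; exists (Ordinal G0); rewrite inE /= num_paths0_gt0.
rewrite /longest.
by have [i Pi ->] := eq_bigmax_cond (fun h : 'I_#|G| => h : nat) P0.
Qed.

Lemma neq_sym (T : eqType) : symmetric [rel x y : T | x != y].
Proof. by move=> x y /=; rewrite eq_sym. Qed.

Lemma neq_irr (T : eqType) : irreflexive [rel x y : T | x != y].
Proof. by move=> x /=; rewrite eqxx. Qed.

Definition complete (n : nat) : sgraph :=
  SGraph (@neq_sym 'I_n) (@neq_irr 'I_n).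

(* Main.v *)
(** In a complete graph every sequence of h+1 distinct vertices traces a path of
    length h, and there are n(n-1)...(n-h) such sequences.  Two of them trace the
    same path exactly when they are equal or reversed: recording the position in
    one of the successive entries of the other gives an injective walk with steps
    +1 and -1 on {0, ..., h}, which never turns back and hence is i |-> i or
    i |-> h - i.  For h >= 1 the two are distinct, so each path is counted twice. *)
Require Import Defs.
From mathcomp Require Import all_boot all_order all_algebra zify.
Set Implicit Arguments.
Unset Strict Implicit.
Unset Printing Implicit Defensive.
Import Order.TTheory GRing.Theory Num.Theory.
Local Open Scope ring_scope.

(** A step up followed by a step down, or the converse, would give [a i.+2 = a i] against
    injectivity, so the first step decides the direction of all; the bound by [h] then leaves only
    one starting value. *)
Lemma injective_walk (h : nat) (a : nat -> nat) :
  (forall i, i < h -> a i.+1 = (a i).+1 \/ a i = (a i.+1).+1)%N ->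
  (forall i j, i <= h -> j <= h -> a i = a j -> i = j)%N ->
  (forall i, i <= h -> a i <= h)%N ->
  (forall i, i <= h -> a i = i)%N \/ (forall i, i <= h -> a i = h - i)%N.
Proof.
case: h => [|h] step inj le_h.
  by left=> i; rewrite leqn0 => /eqP->; apply/eqP; rewrite -leqn0 le_h.
have noturn i : (i.+1 < h.+1 -> a i.+2 <> a i)%N.
  by move=> lt_i /inj; lia.
case: (step 0%N isT) => a01; [left | right].
  have up i : (i < h.+1 -> a i.+1 = (a i).+1)%N.
    elim: i => // i IHi lt_i; have := IHi (ltnW lt_i).
    by have := noturn i lt_i; case: (step _ lt_i); lia.
  have aE i : (i <= h.+1 -> a i = a 0 + i)%N.
    by elim: i => [|i IHi] lt_i; [rewrite addn0 | rewrite up // IHi ?addnS // ltnW].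
  move=> i le_i; have := aE _ (leqnn h.+1); have := aE _ le_i.
  by have := le_h _ (leqnn h.+1); lia.
have down i : (i < h.+1 -> a i = (a i.+1).+1)%N.
  elim: i => // i IHi lt_i; have := IHi (ltnW lt_i).
  by have := noturn i lt_i; case: (step _ lt_i); lia.
have aE i : (i <= h.+1 -> a i + i = a 0)%N.
  elim: i => [|i IHi] lt_i; first by rewrite addn0.
  by have := down i lt_i; have := IHi (ltnW lt_i); lia.
move=> i le_i; have := aE _ (leqnn h.+1); have := aE _ le_i.
by have := le_h 0%N isT; lia.
Qed.

Lemma set2_eq (T : finType) (a b c d : T) :
  [set a; b] = [set c; d] -> (a = c /\ b = d) \/ (a = d /\ b = c).
Proof.
move=> /setP E; move: (E a) (E b) (E c) (E d); rewrite !inE !eqxx ?orbT /=.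
move=> /esym/orP Ha /esym/orP Hb /orP Hc /orP Hd.
by case: Ha Hb Hc Hd => /eqP-> [] /eqP-> [] /eqP Ec [] /eqP Ed; auto.
Qed.

(** The graph demanded by [is_path_graph], as a function of its tuple, so that paths form an image
    whose fibres can be counted. *)
Definition path_graph (T : finType) h (t : h.+1.-tuple T) : set_graph T :=
  ([set x in t],
   [set [set tnth t (widen_ord (leqnSn h) i); tnth t (lift ord0 i)] | i : 'I_h]).

Lemma path_graph_edgeP (T : finType) (x0 : T) h (t : h.+1.-tuple T) e :
  reflect (exists2 i, (i < h)%N & e = [set nth x0 t i; nth x0 t i.+1])
          (e \in (path_graph t).2).
Proof.
apply: (iffP imsetP) => [[i _ ->] | [i lt_i ->]].
  by exists i; rewrite // !(tnth_nth x0).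
by exists (Ordinal lt_i); rewrite // !(tnth_nth x0).
Qed.

Lemma path_graph_rev (T : finType) h (t : h.+1.-tuple T) :
  path_graph (rev_tuple t) = path_graph t.
Proof.
congr pair; first by apply/setP=> x; rewrite !inE mem_rev.
(* Reversal is an involution, so one inclusion, for every tuple, gives equality. *)
have sub (s : h.+1.-tuple T) :
    (path_graph (rev_tuple s)).2 \subset (path_graph s).2.
  apply/subsetP=> e /(path_graph_edgeP (thead s))[i lt_i ->].
  (* Positions [i] and [i.+1] of the reversal are [h - i] and [h - i.+1] of the original. *)
  apply/(path_graph_edgeP (thead s)); exists (h - i.+1)%N; first by lia.
  rewrite /= !nth_rev ?size_tuple 1?setUC; try lia.
  by congr [set nth _ _ _; nth _ _ _]; lia.
apply/eqP; rewrite eqEsubset sub /=.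
have tK : rev_tuple (rev_tuple t) = t by apply: val_inj; rewrite /= revK.
by have := sub (rev_tuple t); rewrite tK.
Qed.

Lemma path_graph_eq (T : finType) h (s t : h.+1.-tuple T) :
  uniq s -> uniq t -> path_graph s = path_graph t ->
  s = t \/ s = rev_tuple t.
Proof.
move=> Us Ut [/setP EV EE]; pose x0 := thead t.
have mem_st x : (x \in s) = (x \in t) by have := EV x; rewrite !inE.
have szs : size s = h.+1 by rewrite size_tuple.
have szt : size t = h.+1 by rewrite size_tuple.
(* The walk: the position in [t] of entry [i] of [s]. *)
pose a i := index (nth x0 s i) t.
have in_t i : (i <= h)%N -> nth x0 s i \in t.
  by move=> le_i; rewrite -mem_st mem_nth // szs.
have nth_a i : (i <= h)%N -> nth x0 t (a i) = nth x0 s i.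
  by move=> le_i; rewrite nth_index // in_t.
have [|i j le_i le_j aij|i le_i|aE|aE] := @injective_walk h a.
- move=> i lt_i.
  (* The edge sets agree, so consecutive entries of [s] are neighbours in [t]; the two ways of
     matching the ends give the steps +1 and -1. *)
  have /(path_graph_edgeP x0)[j lt_j] :
      [set nth x0 s i; nth x0 s i.+1] \in (path_graph t).2.
    by rewrite -[_.2]EE; apply/(path_graph_edgeP x0); exists i.
  by case/set2_eq=> -[Ei Ei1]; [left | right];
     rewrite /a Ei Ei1 !index_uniq // szt ltnS // ltnW.
- apply/eqP; rewrite -(nth_uniq x0 _ _ Us) ?szs //.
  by rewrite -nth_a // -(nth_a j) // aij.
- by rewrite -ltnS -szt index_mem in_t.
- left; apply/val_inj/(@eq_from_nth _ x0); rewrite /= ?szs ?szt // => i lt_i.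
  by rewrite -nth_a // aE.
right; apply/val_inj/(@eq_from_nth _ x0); rewrite /= ?size_rev ?szs ?szt //.
by move=> i lt_i; rewrite nth_rev szt // -nth_a // aE // subSS.
Qed.

(** The first entry of the reversal is the last entry of [t], which differs from the first because
    [t] has at least two entries, all distinct. *)
Lemma rev_tuple_neq (T : finType) h (t : h.+2.-tuple T) :
  uniq t -> t != rev_tuple t.
Proof.
move=> Ut; apply/eqP=> /(congr1 (fun s : _.-tuple _ => nth (thead t) s 0)) /=.
rewrite nth_rev size_tuple // => /eqP.
by rewrite nth_uniq ?size_tuple.
Qed.

Definition uniq_tuples (T : finType) m : {set m.-tuple T} := [set t : m.-tuple T | uniq t].

Lemma card_uniq_tuplesT (T : finType) m : #|uniq_tuples T m| = (#|T| ^_ m)%N.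
Proof.
rewrite -(card_uniq_tuples m predT); apply: eq_card => t.
by rewrite !inE all_predT.
Qed.

(** Sorting the tuples of distinct entries by the path they trace gives fibres [{t, rev_tuple t}] of
    exactly two elements; [h.+2] entries mean length at least 1. *)
Lemma card_path_graphs (T : finType) h :
  (#|[set path_graph t | t in uniq_tuples T h.+2]| * 2 = #|T| ^_ h.+2)%N.
Proof.
rewrite -card_uniq_tuplesT -[RHS]sum1_card (partition_big_imset (@path_graph T h.+1)) /=.
rewrite -sum_nat_const; apply: eq_bigr => _ /imsetP[t Ut ->].
rewrite inE in Ut; have := cards2 t (rev_tuple t); rewrite rev_tuple_neq // => <-.
rewrite sum1dep_card; apply/esym/eq_card=> s; rewrite !inE.
apply/andP/orP=> [[Us /eqP /(path_graph_eq Us Ut)] | ].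
  by case=> ->; [left | right].
by case=> /eqP->; rewrite ?path_graph_rev ?rev_uniq.
Qed.

(** Being a subgraph is automatic here: the ends of each edge are distinct entries of the tuple, and
    distinct vertices are adjacent. *)
Lemma paths_complete n h :
  paths (complete n) h = [set path_graph t | t in uniq_tuples 'I_n h.+1].
Proof.
apply/setP=> H; rewrite inE; apply/andP/imsetP => [[_ /existsP[t]] | [t]].
  case/and3P=> Ut /eqP H1 /eqP H2; exists t; first by rewrite inE.
  by case: H H1 H2 => ? ? /= -> ->.
rewrite inE => Ut ->{H}; split; last first.
  by apply/existsP; exists t; rewrite Ut !eqxx.
apply/andP; split.
  apply/subsetP=> e /(path_graph_edgeP (thead t))[i lt_i ->].
  apply: imset2_f; rewrite !inE //=.
  by rewrite nth_uniq ?size_tuple ?ltnS //; lia.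
apply/forall_inP=> e /(path_graph_edgeP (thead t))[i lt_i ->].
apply/subsetP=> x; rewrite !inE.
by case/orP=> /eqP->; rewrite mem_nth // size_tuple ltnS // ltnW.
Qed.

(** A tuple with one entry is its own reversal, so nothing is counted twice at length 0. *)
Lemma num_paths0_complete n : num_paths (complete n) 0 = n.
Proof.
rewrite /num_paths paths_complete card_in_imset.
  by rewrite card_uniq_tuplesT card_ord ffactn1.
move=> s t; rewrite !inE => Us Ut /(path_graph_eq Us Ut)[] // ->.
by apply: val_inj; case/tupleP: t {Ut} => x t; rewrite (tuple0 t).
Qed.

Lemma num_paths_complete n h :
  (0 < h)%N -> (num_paths (complete n) h * 2 = n ^_ h.+1)%N.
Proof.
by case: h => // h _; rewrite /num_paths paths_complete card_path_graphs card_ord.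
Qed.

(** A path has at most [n] vertices, which bounds its length by [n.-1]; the count at that length is
    positive. *)
Lemma longest_complete n : (0 < n)%N -> longest (complete n) = n.-1.
Proof.
move=> n_gt0; have cardK : #|complete n| = n by rewrite card_ord.
have [] := @longestP (complete n); rewrite ?cardK //.
move=> /num_paths_gt0_lt; rewrite cardK => lt_n max_n.
suff /max_n : (0 < num_paths (complete n) n.-1)%N by lia.
(* The doubled count covers only positive lengths, so [n = 1] is settled by the count at length
   0. *)
case: n n_gt0 {cardK lt_n max_n} => // -[|n] _; first by rewrite num_paths0_complete.
by rewrite -(ltn_pmul2r (isT : 0 < 2)%N) num_paths_complete //= ffact_gt0.
Qed.

(** For [m <= n] no factor [n - i] of the falling factorial is truncated, so each subtraction casts
    to that of the ring. *)
Lemma natr_ffact (R : pzRingType) n m : (m <= n)%N ->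
  (n ^_ m)%:R = \prod_(0 <= i < m) (n%:R - i%:R) :> R.
Proof.
move=> le_mn; rewrite ffact_prod natr_prod big_mkord.
by apply: eq_bigr => i _; rewrite natrB // ltnW // (leq_trans _ le_mn).
Qed.

Theorem theorem1 (n : nat) (n_gt0 : (0 < n)%N) :
  (forall h : nat, (1 <= h <= n - 1)%N ->
     (num_paths (complete n) h)%:R
       = 2%:R^-1 * \prod_(0 <= i < h.+1) (n%:R - i%:R) :> rat)
  /\ ([seq (p%:R : rat) | p <- path_sequence (complete n)]
       = n%:R :: [seq 2%:R^-1 * \prod_(0 <= i < h.+1) (n%:R - i%:R)
                 | h <- iota 1 (n - 1)])
  /\ num_paths (complete n) 0 = n
  /\ longest (complete n) = (n - 1)%N.
Proof.
have numE h : (1 <= h <= n - 1)%N -> (num_paths (complete n) h)%:R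
    = 2%:R^-1 * \prod_(0 <= i < h.+1) (n%:R - i%:R) :> rat.
  case/andP=> h_gt0 le_h; rewrite -natr_ffact; last by lia.
  by rewrite -num_paths_complete // natrM mulrC mulfK.
have longE : longest (complete n) = (n - 1)%N.
  by rewrite longest_complete // subn1.
split=> //; split; last by rewrite num_paths0_complete.
rewrite /path_sequence longE /mkseq /= num_paths0_complete -map_comp.
congr cons; apply/eq_in_map => h; rewrite mem_iota => h_range /=.
by apply: numE; lia.
Qed.
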